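(* Let $p$ be a prime and let $\psi:\mathbb{N}\to\mathbb{R}^+$ satisfy $\psi(n)\to\infty$ as $n\to\infty$. Let \[E_{\inf}(\psi)=\Big\{x\in p\mathbb{Z}_p:\ \liminf_{n\to\infty}\frac{a_n(x)}{\psi(n)}=1\Big\},\qquad E(\psi)=\Big\{x\in p\mathbb{Z}_p:\ \lim_{n\to\infty}\frac{a_n(x)}{\psi(n)}=1\Big\}.\] Then $\dim_{\rm H}E_{\inf}(\psi)=\dim_{\rm H}E(\psi)=0$.
   Context: $\mathbb{Q}_p$ is the field of $p$-adic numbers with absolute value $|x|_p=p^{-v_p(x)}$, $\mathbb{Z}_p=\{x:|x|_p\le1\}$, $p\mathbb{Z}_p$ its maximal ideal. Schneider's $p$-adic continued fraction map $T_p:p\mathbb{Z}_p\to p\mathbb{Z}_p$ is $T_p(0)=0$ and $T_p(x)=p^{a_1(x)}/x-b_1(x)$ for $x\neq0$, where $a_1(x)=v_p(x)$ and $b_1(x)\in\{1,\dots,p-1\}$ satisfies $p^{a_1(x)}/x\equiv b_1(x)\pmod p$. For $n\ge2$, $a_n(x)=a_1(T_p^{n-1}(x))$, $b_n(x)=b_1(T_p^{n-1}(x))$. Hausdorff dimension is with respect to the metric $|x-y|_p$. *)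

(* Defs.v *)
From HB Require Import structures.
From mathcomp Require Import all_boot all_order all_algebra fraction zify.
From mathcomp Require Import all_classical all_reals all_analysis.

Set Implicit Arguments.
Unset Strict Implicit.
Unset Printing Implicit Defensive.
Import Order.TTheory GRing.Theory Num.Theory.
Import numFieldNormedType.Exports.
Local Open Scope classical_set_scope.
Local Open Scope ring_scope.

(* Z_p is the inverse limit of the rings Z/p^n: x n is the residue of x modulo
   p^n, normalised in [0, p^n[ (the coherence equation forces the range). *)
Record padic_int (p : nat) (p_pr : prime p) := PadicInt {
  residue :> nat -> int;
  _ : `[< forall n, residue n = (residue n.+1 %% (p ^ n)%:Z)%Z >] }.

HB.instance Definition _ p (p_pr : prime p) := [isSub for @residue p p_pr].
(* The classical equality is used rather than the one inherited from residue,
   because unfolding the latter makes failing unifications in Q_p very slow. *)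
HB.instance Definition _ p (p_pr : prime p) :=
  gen_eqMixin (padic_int p_pr).
HB.instance Definition _ p (p_pr : prime p) :=
  gen_choiceMixin (padic_int p_pr).

Section PadicInt.
Variables (p : nat) (p_pr : prime p).
Local Notation Zp := (padic_int p_pr).
Local Notation pn n := ((p ^ n)%:Z).
Implicit Types (x y z : Zp) (f g : nat -> int).

Lemma residueE x n : x n = (x n.+1 %% pn n)%Z.
Proof. by case: x => x /= /asboolP. Qed.

Lemma pn_neq0 n : pn n != 0.
Proof. by rewrite eqz_nat -lt0n expn_gt0 prime_gt0. Qed.

Lemma residue_mod x n : (x n %% pn n)%Z = x n.
Proof. by rewrite residueE modz_mod. Qed.

Lemma padic_int_eqP x y : (forall n, x n = y n) -> x = y.
Proof. by move=> xy; apply/val_inj/funext. Qed.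

Definition coherent f := forall n, (f n.+1 = f n %[mod pn n])%Z.

Lemma residue_coherent x : coherent x.
Proof. by move=> n; rewrite [x n]residueE modz_mod. Qed.

Lemma dvd_pn m n : (m <= n)%N -> (pn m %| pn n)%Z.
Proof. by move=> mn; rewrite dvdzE /= dvdn_exp2l. Qed.

Lemma modz_pn m n (a : int) : (m <= n)%N -> ((a %% pn n)%Z %% pn m)%Z = (a %% pn m)%Z.
Proof.
move=> mn; apply/eqP; rewrite eqz_mod_dvd {2}(divz_eq a (pn n)) opprD addrCA subrr addr0.
by rewrite dvdzE abszN -dvdzE dvdz_mull// dvd_pn.
Qed.

Lemma mod_eq0 (a d : int) : ((a %% d)%Z == 0) = (d %| a)%Z.
Proof. by apply/eqP/idP => /dvdz_mod0P. Qed.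

Lemma of_coherent_subproof f : coherent f ->
  `[< forall n, (f n %% pn n)%Z = ((f n.+1 %% pn n.+1)%Z %% pn n)%Z >].
Proof. by move=> cf; apply/asboolP => n; rewrite modz_pn// cf. Qed.

Definition of_coherent f (cf : coherent f) : Zp :=
  PadicInt p_pr (of_coherent_subproof cf).

Lemma add_subproof x y : coherent (fun n => x n + y n).
Proof. by move=> n; rewrite -modzDm !residue_coherent modzDm. Qed.
Lemma opp_subproof x : coherent (fun n => - x n).
Proof. by move=> n; rewrite -modzNm residue_coherent modzNm. Qed.
Lemma mul_subproof x y : coherent (fun n => x n * y n).
Proof. by move=> n; rewrite -modzMm !residue_coherent modzMm. Qed.
Lemma cst_subproof (a : int) : coherent (fun=> a).
Proof. by []. Qed.

Definition zp_add x y := of_coherent (add_subproof x y).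
Definition zp_opp x := of_coherent (opp_subproof x).
Definition zp_mul x y := of_coherent (mul_subproof x y).
Definition zp_cst a := of_coherent (cst_subproof a).

Lemma zp_addA : associative zp_add.
Proof. by move=> x y z; apply: padic_int_eqP => n /=; rewrite modzDmr modzDml addrA. Qed.
Lemma zp_addC : commutative zp_add.
Proof. by move=> x y; apply: padic_int_eqP => n /=; rewrite addrC. Qed.
Lemma zp_add0 : left_id (zp_cst 0) zp_add.
Proof. by move=> x; apply: padic_int_eqP => n /=; rewrite mod0z add0r residue_mod. Qed.
Lemma zp_addN : left_inverse (zp_cst 0) zp_opp zp_add.
Proof. by move=> x; apply: padic_int_eqP => n /=; rewrite modzDml addNr. Qed.
HB.instance Definition _ :=
  GRing.isZmodule.Build Zp zp_addA zp_addC zp_add0 zp_addN.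

Lemma zp_mulA : associative zp_mul.
Proof. by move=> x y z; apply: padic_int_eqP => n /=; rewrite modzMmr modzMml mulrA. Qed.
Lemma zp_mulC : commutative zp_mul.
Proof. by move=> x y; apply: padic_int_eqP => n /=; rewrite mulrC. Qed.
Lemma zp_mul1 : left_id (zp_cst 1) zp_mul.
Proof. by move=> x; apply: padic_int_eqP => n /=; rewrite modzMml mul1r residue_mod. Qed.
Lemma zp_mulDl : left_distributive zp_mul zp_add.
Proof. by move=> x y z; apply: padic_int_eqP => n /=; rewrite modzMml modzDm mulrDl. Qed.
Lemma zp_1neq0 : zp_cst 1 != 0.
Proof.
apply/eqP => /(congr1 (fun z : Zp => z 1%N)) /=.
by rewrite expn1 mod0z modz_small// ltz_nat prime_gt1.
Qed.
HB.instance Definition _ := GRing.Zmodule_isComNzRing.Build Zp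
  zp_mulA zp_mulC zp_mul1 zp_mulDl zp_1neq0.

Definition zp_unit : pred Zp := fun x => `[< exists y, y * x = 1 >].
Definition zp_inv x : Zp :=
  if pselect (exists y, y * x = 1) is left h then projT1 (cid h) else x.

Lemma zp_mulV : {in zp_unit, left_inverse 1 zp_inv *%R}.
Proof.
move=> x /asboolP xu; rewrite /zp_inv; case: pselect => // h.
exact: projT2 (cid h).
Qed.
Lemma zp_unitP x y : y * x = 1 -> zp_unit x.
Proof. by move=> yx; apply/asboolP; exists y. Qed.
Lemma zp_inv_out : {in [predC zp_unit], zp_inv =1 id}.
Proof.
move=> x; rewrite inE => /negP xu; rewrite /zp_inv; case: pselect => // h.
by case: xu; apply/asboolP.
Qed.
HB.instance Definition _ := GRing.ComNzRing_hasMulInverse.Build Zp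
  zp_mulV zp_unitP zp_inv_out.

Lemma residueD x y n : (x + y) n = ((x n + y n) %% pn n)%Z. Proof. by []. Qed.
Lemma residueM x y n : (x * y) n = ((x n * y n) %% pn n)%Z. Proof. by []. Qed.
Lemma residueN x n : (- x) n = ((- x n) %% pn n)%Z. Proof. by []. Qed.
Lemma residue0 n : (0 : Zp) n = 0. Proof. by rewrite /= mod0z. Qed.

Lemma residue_le x m n : (m <= n)%N -> x m = (x n %% pn m)%Z.
Proof.
move=> /subnK <-; elim: (n - m)%N => [|k IH]; first by rewrite residue_mod.
by rewrite IH residueE modz_pn ?leq_addl.
Qed.

Lemma residue_eq0 x m n : (m <= n)%N -> (x m == 0) = (pn m %| x n)%Z.
Proof. by move=> mn; rewrite (residue_le x mn) mod_eq0. Qed.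

Lemma residue_neq0 x : x != 0 -> exists n, x n.+1 != 0.
Proof.
move=> x0; apply: contrapT => xn; case/eqP: x0; apply: padic_int_eqP => n.
rewrite residue0 residueE; case: (eqVneq (x n.+1) 0) => [->|h].
  by rewrite mod0z.
by case: xn; exists n.
Qed.

Lemma dvdz_pnM (a b : int) m n : (pn (m + n).+1 %| a * b)%Z ->
  (pn m.+1 %| a)%Z || (pn n.+1 %| b)%Z.
Proof.
rewrite !dvdzE abszM /=; set a' := `|a|%N; set b' := `|b|%N.
have [->|a0] := posnP a'; first by rewrite dvdn0.
have [->|b0] := posnP b'; first by rewrite !dvdn0 orbT.
rewrite !pfactor_dvdn ?muln_gt0 ?a0// lognM//.
rewrite ltnNge; apply: contraR; rewrite negb_or -!ltnNge => /andP[].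
by rewrite !ltnS; apply: leq_add.
Qed.

Lemma residueM_neq0 x y m n : x m.+1 != 0 -> y n.+1 != 0 ->
  (x * y) (m + n).+1 != 0.
Proof.
rewrite (@residue_eq0 x m.+1 (m + n).+1) ?ltnS ?leq_addr//.
rewrite (@residue_eq0 y n.+1 (m + n).+1) ?ltnS ?leq_addl// => xm yn.
by rewrite residueM mod_eq0; apply/negP => /dvdz_pnM; rewrite (negbTE xm) (negbTE yn).
Qed.

Lemma zp_idomain : GRing.integral_domain_axiom Zp.
Proof.
move=> x y xy0; apply/norP => -[/residue_neq0[m xm] /residue_neq0[n yn]].
by have := residueM_neq0 xm yn; rewrite xy0 residue0 eqxx.
Qed.
HB.instance Definition _ := GRing.ComUnitRing_isIntegral.Build Zp zp_idomain.

(* The largest n such that p^n divides x, for x nonzero; 0 if x = 0. *)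
Definition zp_val x : nat :=
  if pselect (exists n, x n.+1 != 0) is left h then ex_minn h else 0%N.

Lemma zp_valP x : x != 0 ->
  x (zp_val x).+1 != 0 /\ forall n, (n <= zp_val x)%N -> x n = 0.
Proof.
move=> /residue_neq0 h; rewrite /zp_val; case: pselect => // h'.
case: ex_minnP => v xv vmin; split=> // -[|n] nv.
  by rewrite residueE expn0 modz1.
by apply/eqP/negPn/negP => /vmin; rewrite leqNgt nv.
Qed.

Lemma zp_val_uniq x n : x n.+1 != 0 -> x n = 0 -> zp_val x = n.
Proof.
move=> xn1 xn0; have x0 : x != 0.
  by apply: contra xn1 => /eqP ->; rewrite residue0.
have [xv xlt] := zp_valP x0; apply: anti_leq; apply/andP; split.
  by rewrite leqNgt; apply/negP => h; move: xn1; rewrite (xlt n.+1 h) eqxx.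
rewrite leqNgt; apply/negP => h; move: xv.
by rewrite (residue_le x h) xn0 mod0z eqxx.
Qed.

Lemma zp_val_gt x n : x != 0 -> x n.+1 = 0 -> (n < zp_val x)%N.
Proof.
move=> x0 xn; have [xv _] := zp_valP x0; rewrite ltnNge; apply/negP => h.
by move: xv; rewrite (residue_le x (m := (zp_val x).+1) (n := n.+1) h) xn mod0z eqxx.
Qed.

Lemma residue_nat k n : (k%:R : Zp) n = (k%:Z %% pn n)%Z.
Proof.
elim: k => [|k IH]; first by rewrite residue0 mod0z.
by rewrite -natr1 residueD IH /= modzDmr modzDml -PoszD addn1.
Qed.

Lemma residue_lead x : x != 0 -> exists2 u : nat,
  coprime u p & x (zp_val x).+1 = u%:Z * pn (zp_val x).
Proof.
move=> x0; have [xv xlt] := zp_valP x0; set k := zp_val x in xv xlt *.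
have xk : (pn k %| x k.+1)%Z by rewrite -(residue_eq0 x (leqnSn k)) xlt.
have x_ge0 : 0 <= x k.+1 by rewrite residueE modz_ge0// pn_neq0.
have [u xu] : exists u : nat, x k.+1 = u%:Z * pn k.
  exists (`|x k.+1| %/ p ^ k)%N.
  by move: xk; rewrite dvdzE /= -PoszM => /divnK ->; rewrite gez0_abs.
exists u => //; rewrite coprime_sym prime_coprime//; apply/negP => /dvdnP[w uw].
move: xv; rewrite -residue_mod mod_eq0 xu uw PoszM -mulrA -PoszM -expnS.
by rewrite dvdz_mull.
Qed.

Lemma zp_digit x y : x != 0 -> y != 0 -> zp_val x = zp_val y ->
  exists2 c : nat, (0 < c < p)%N & (x - c%:R * y) (zp_val y).+1 = 0.
Proof.
move=> x0 y0 xy; have [u up xu] := residue_lead x0; have [v vp yv] := residue_lead y0.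
move: xu; rewrite xy; set k := zp_val y in yv * => xu.
have p0 := prime_gt0 p_pr.
have [w wv] : exists w, (w * v = 1 %[mod p])%N.
  have v0 : (0 < v)%N.
    rewrite lt0n; apply: contraTneq vp => ->.
    by rewrite /coprime gcd0n; have := prime_gt1 p_pr; case: (p) => [|[]].
  have [w z wz _] := egcdnP p v0; exists w.
  by move: vp; rewrite /coprime => /eqP vp; rewrite wz vp modnMDl.
have cu : (u * w %% p * v = u %[mod p])%N.
  by rewrite modnMml -mulnA -modnMmr wv modnMmr muln1.
exists (u * w %% p)%N.
  rewrite ltn_mod p0 andbT lt0n; apply/eqP => h.
  move: cu; rewrite h mul0n mod0n => /esym/eqP; rewrite -/(dvdn p u).
  by move=> pu; move: up; rewrite coprime_sym prime_coprime// pu.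
set c := (u * w %% p)%N in cu *.
rewrite residueD residueN residueM residue_nat modzMml modzNm modzDmr xu yv.
apply/eqP; rewrite mod_eq0 mulrA -mulrBl expnS PoszM.
apply: dvdz_mul => //.
rewrite -eqz_mod_dvd -PoszM !modz_nat; apply/eqP; congr Posz.
by rewrite cu.
Qed.

Lemma zp_valM x y : x != 0 -> y != 0 -> zp_val (x * y) = (zp_val x + zp_val y)%N.
Proof.
move=> x0 y0; have [xv xlt] := zp_valP x0; have [yv ylt] := zp_valP y0.
apply: zp_val_uniq; first exact: residueM_neq0.
apply/eqP; rewrite residueM mod_eq0 expnD PoszM; apply: dvdz_mul.
  by rewrite -(residue_eq0 x (leq_addr _ _)) xlt.
by rewrite -(residue_eq0 y (leq_addl _ _)) ylt.
Qed.

Lemma zp_valD x y : x != 0 -> y != 0 -> x + y != 0 ->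
  (minn (zp_val x) (zp_val y) <= zp_val (x + y)%R)%N.
Proof.
move=> x0 y0 xy0; have [_ xlt] := zp_valP x0; have [_ ylt] := zp_valP y0.
have [sv _] := zp_valP xy0; rewrite leqNgt; apply/negP; rewrite leq_min => /andP[hx hy].
by move: sv; rewrite residueD xlt ?ylt// addr0 mod0z eqxx.
Qed.

End PadicInt.

Local Notation "x %:F" := (@FracField.tofrac _ x) : ring_scope.

Notation padic p_pr := {fraction (padic_int p_pr)}.

Section PadicVal.
Local Open Scope quotient_scope.
Local Open Scope ring_scope.
Variables (p : nat) (p_pr : prime p).
Local Notation Zp := (padic_int p_pr).
Local Notation Qp := (padic p_pr).
Implicit Types (x y : Qp) (a b : Zp).

(* v_p on Q_p; the junk value at 0 is never used below. *)
Definition padic_val x : int :=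
  (zp_val (repr x).1)%:Z - (zp_val (repr x).2)%:Z.

Lemma padic_frac x : x = (repr x).1%:F / (repr x).2%:F.
Proof.
have d0 := denom_ratioP (repr x).
suff h : x * (repr x).2%:F = (repr x).1%:F.
  by rewrite -h mulfK// tofrac_eq0.
rewrite -{1}[x]reprK; move: (repr x) d0 => r r0.
change (FracField.mul (\pi_(FracField.type Zp) r) (r.2)%:F = (r.1)%:F).
rewrite !piE; apply/eqmodP => /=.
rewrite /FracField.equivf /FracField.mulf !numden_Ratio ?oner_eq0 ?mulr1//.
by rewrite mulrC.
Qed.

Lemma padic_val_frac a b : a != 0 -> b != 0 ->
  padic_val (a%:F / b%:F) = (zp_val a)%:Z - (zp_val b)%:Z.
Proof.
move=> a0 b0; rewrite /padic_val; set x : Qp := _ / _.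
have d0 := denom_ratioP (repr x).
have xE : x * b%:F = a%:F by rewrite mulfVK// tofrac_eq0.
have xe := padic_frac x; set n := (repr x).1 in xe *; set d := (repr x).2 in xe d0 *.
have n0 : n != 0.
  apply: contra a0 => /eqP n0; move: xE; rewrite xe n0 tofrac0 mul0r mul0r => /esym/eqP.
  by rewrite tofrac_eq0.
have /eqP : n%:F * b%:F = a%:F * d%:F :> Qp.
  by rewrite -xE xe -mulrA [b%:F * _]mulrC mulrA mulfVK// tofrac_eq0.
rewrite -!tofracM tofrac_eq => /eqP/(congr1 (@zp_val p p_pr)).
rewrite !zp_valM// => /(congr1 Posz); rewrite !PoszD => h.
by apply/eqP; rewrite subr_eq addrAC -h addrK.
Qed.

Variant padic_spec x : Type :=
  PadicSpec a b of a != 0 & b != 0 & x = a%:F / b%:F &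
    padic_val x = (zp_val a)%:Z - (zp_val b)%:Z.

Lemma padicP x : x != 0 -> padic_spec x.
Proof.
move=> x0; have xe := padic_frac x.
apply: (PadicSpec (a := (repr x).1) (b := (repr x).2)) => //.
- by apply: contra x0 => /eqP n0; rewrite xe n0 tofrac0 mul0r.
- exact: denom_ratioP.
Qed.

Lemma padic_valM x y : x != 0 -> y != 0 ->
  padic_val (x * y) = padic_val x + padic_val y.
Proof.
case/padicP=> a b a0 b0 xe -> /padicP[c d c0 d0 ye ->].
have -> : x * y = (a * c)%:F / (b * d)%:F.
  by rewrite !tofracM xe ye invfM mulrACA.
by rewrite padic_val_frac ?mulf_neq0// !zp_valM// !PoszD opprD addrACA.
Qed.

(* Prevents unification from evaluating valuations. *)
#[global] Opaque padic_val.

Lemma padic_val1 : padic_val 1 = 0.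
Proof.
have := @padic_valM 1 1 (oner_neq0 _) (oner_neq0 _).
by rewrite mulr1 => /eqP; rewrite -subr_eq subrr eq_sym => /eqP.
Qed.

Lemma padic_valV x : x != 0 -> padic_val x^-1 = - padic_val x.
Proof.
move=> x0; have V0 := invr_neq0 x0.
have := padic_valM V0 x0.
rewrite (mulVf x0) padic_val1.
move/esym/eqP.
rewrite addr_eq0.
by move/eqP.
Qed.

Lemma padic_valN x : padic_val (- x) = padic_val x.
Proof.
have [->|x0] := eqVneq x 0; first by rewrite oppr0.
have N1 : (-1 : Qp) != 0 by rewrite oppr_eq0 oner_eq0.
have h : padic_val (-1) = 0.
  have := padic_valM N1 N1; rewrite mulrNN mulr1 padic_val1 => /esym/eqP.
  by rewrite -mulr2n mulrn_eq0 => /eqP.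
by rewrite -mulN1r padic_valM// h add0r.
Qed.

Lemma padic_valD x y : x != 0 -> y != 0 -> x + y != 0 ->
  Num.min (padic_val x) (padic_val y) <= padic_val (x + y).
Proof.
case/padicP=> a b a0 b0 xe -> /padicP[c d c0 d0 ye ->].
have -> : x + y = (a * d + c * b)%:F / (b * d)%:F.
  by rewrite tofracD !tofracM xe ye addf_div ?tofrac_eq0.
move=> s0; have n0 : a * d + c * b != 0.
  by apply: contra s0 => /eqP ->; rewrite tofrac0 mul0r.
rewrite padic_val_frac ?mulf_neq0//.
have := zp_valD (mulf_neq0 a0 d0) (mulf_neq0 c0 b0) n0.
rewrite !zp_valM// geq_min ge_min.
move: (zp_val _) (zp_val a) (zp_val b) (zp_val c) (zp_val d) => s u v w t.
lia.
Qed.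

Definition padic_abs (R : realType) x : R :=
  if x == 0 then 0 else (p%:R : R) ^ (- padic_val x).

Lemma padic_absN (R : realType) x : padic_abs R (- x) = padic_abs R x.
Proof. by rewrite /padic_abs oppr_eq0 padic_valN. Qed.

Lemma padic_abs_gt0 (R : realType) x : x != 0 -> 0 < padic_abs R x.
Proof.
by move=> x0; rewrite /padic_abs (negbTE x0) exprz_gt0// ltr0n prime_gt0.
Qed.

Lemma padic_abs_ge0 (R : realType) x : 0 <= padic_abs R x.
Proof.
by have [->|/(padic_abs_gt0 R)/ltW//] := eqVneq x 0; rewrite /padic_abs eqxx.
Qed.

Lemma padic_absM (R : realType) x y :
  padic_abs R (x * y) = padic_abs R x * padic_abs R y.
Proof.
rewrite /padic_abs mulf_eq0; case: eqVneq => [|x0]; first by rewrite mul0r.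
case: eqVneq => [|y0] /=; first by rewrite mulr0.
have p0 : (p%:R : R) != 0 by rewrite pnatr_eq0 -lt0n prime_gt0.
by rewrite (padic_valM x0 y0) opprD expfzDr.
Qed.

Lemma ler_padic_abs (R : realType) x y : x != 0 -> y != 0 ->
  (padic_abs R x <= padic_abs R y) = (padic_val y <= padic_val x).
Proof.
move=> x0 y0; rewrite /padic_abs (negbTE x0) (negbTE y0).
by rewrite ler_eXz2l ?lerN2// ltr1n prime_gt1.
Qed.

Lemma padic_abs1 (R : realType) : padic_abs R 1 = 1.
Proof.
rewrite /padic_abs (negbTE (oner_neq0 _)) padic_val1 oppr0.
exact: expr0z.
Qed.

Lemma padic_abs_le1 (R : realType) x : x != 0 ->
  (padic_abs R x <= 1) = (0 <= padic_val x).
Proof.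
by move=> x0; rewrite -(padic_abs1 R) (ler_padic_abs R x0 (oner_neq0 _)) padic_val1.
Qed.

Lemma padic_absD (R : realType) x y :
  padic_abs R (x + y) <= Num.max (padic_abs R x) (padic_abs R y).
Proof.
have [->|x0] := eqVneq x 0; first by rewrite add0r le_max lexx orbT.
have [->|y0] := eqVneq y 0; first by rewrite addr0 le_max lexx.
have [->|s0] := eqVneq (x + y) 0.
  by rewrite {1}/padic_abs eqxx le_max padic_abs_ge0.
by rewrite le_max !ler_padic_abs// -ge_min padic_valD.
Qed.

Lemma zp_p_neq0 : (p%:R : Zp) != 0.
Proof.
have r2 : (p%:R : Zp) 2%N != 0.
  rewrite residue_nat modz_small ?eqz_nat -?lt0n ?prime_gt0//.
  by rewrite ltz_nat /= ltn_Pmulr ?prime_gt1 ?prime_gt0.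
by apply: contra r2 => /eqP ->; rewrite residue0.
Qed.

Lemma padic_p_neq0 : (p%:R : Qp) != 0.
Proof. by have := zp_p_neq0; rewrite -tofrac_eq0 rmorph_nat. Qed.

Lemma padic_val_p : padic_val (p%:R : Qp) = 1.
Proof.
have h : zp_val (p%:R : Zp) = 1%N.
  apply: zp_val_uniq; rewrite residue_nat; last by rewrite expn1 modzz.
  rewrite modz_small ?eqz_nat -?lt0n ?prime_gt0//.
  by rewrite ltz_nat /= ltn_Pmulr ?prime_gt1 ?prime_gt0.
have h1 : zp_val (1 : Zp) = 0%N.
  apply: zp_val_uniq; rewrite (residue_nat p_pr 1) ?expn0 ?modz1// expn1.
  by rewrite modz_small// ltz_nat prime_gt1.
have p0 := zp_p_neq0.
have -> : (p%:R : Qp) = (p%:R : Zp)%:F / (1 : Zp)%:F.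
  by rewrite tofrac1 divr1 rmorph_nat.
by rewrite padic_val_frac ?oner_neq0// h h1.
Qed.

Lemma padic_val_pX (n : int) : padic_val ((p%:R : Qp) ^ n) = n.
Proof.
have hX m : padic_val ((p%:R : Qp) ^+ m) = m%:Z.
  elim: m => [|m IH]; first by rewrite expr0 padic_val1.
  rewrite exprS padic_valM ?expf_neq0 ?padic_p_neq0// IH padic_val_p.
  by rewrite -PoszD.
case: n => m; first exact: hX.
rewrite NegzE; have -> : (p%:R : Qp) ^ (- m.+1%:Z) = (p%:R ^+ m.+1)^-1 by [].
by rewrite padic_valV ?expf_neq0 ?padic_p_neq0// hX.
Qed.

End PadicVal.

(* Q_p with the metric |x - y|_p, whose values are taken in R. *)
Definition padic_metric (R : realType) p (p_pr : prime p) : Type := padic p_pr.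
HB.instance Definition _ R p (p_pr : prime p) :=
  Choice.copy (@padic_metric R p p_pr) (padic p_pr).

Section PadicMetric.
Variables (R : realType) (p : nat) (p_pr : prime p).
Local Notation Qp := (padic p_pr).

Definition padic_dist (x y : Qp) : R := padic_abs R (x - y).

Lemma padic_distxx x : padic_dist x x = 0.
Proof. by rewrite /padic_dist subrr /padic_abs eqxx. Qed.

Lemma padic_dist_eq0 x y : padic_dist x y = 0 -> x = y.
Proof.
move=> d0; apply/eqP; rewrite -subr_eq0; apply/negPn/negP.
by move=> /(padic_abs_gt0 R); rewrite -/(padic_dist x y) d0 ltxx.
Qed.

Lemma padic_distC x y : padic_dist x y = padic_dist y x.
Proof. by rewrite /padic_dist -padic_absN opprB. Qed.

Lemma padic_dist_triangle y x z :
  padic_dist x z <= padic_dist x y + padic_dist y z.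
Proof.
rewrite /padic_dist -(subrKA y) (le_trans (padic_absD _ _ _))//.
by rewrite ge_max lerDl lerDr !padic_abs_ge0.
Qed.

HB.instance Definition _ := isMetric.Build R (padic_metric R p_pr)
  padic_distxx padic_dist_eq0 padic_distC padic_dist_triangle.

End PadicMetric.

Section Hausdorff.
Variables (R : realType) (T : metricType R).
Implicit Types (A U : set T) (s delta : R).
Local Open Scope ereal_scope.

(* -oo for the empty set *)
Definition diam U : \bar R :=
  ereal_sup [set (mdist z.1 z.2)%:E | z in U `*` U].

(* The empty set has weight 0 for every s, including s = 0, while a singleton
   has weight 1 for s = 0 (0 `^ 0 = 1). *)
Definition diam_pow s U : \bar R := if U == set0 then 0 else diam U `^ s.

Definition hausdorff_premeasure s delta A : \bar R :=
  ereal_inf [set \sum_(0 <= k <oo) diam_pow s (U k) | U in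
    [set U : (set T)^nat |
      A `<=` \bigcup_k U k /\ forall k, diam (U k) <= delta%:E]].

Definition hausdorff_measure s A : \bar R :=
  ereal_sup [set hausdorff_premeasure s delta A | delta in [set e : R | (0 < e)%R]].

Definition hausdorff_dim A : \bar R :=
  ereal_inf [set s%:E | s in
    [set s : R | (0 <= s)%R /\ hausdorff_measure s A = 0]].

End Hausdorff.

Section Schneider.
Variables (p : nat) (p_pr : prime p).
Local Notation Qp := (padic p_pr).
Implicit Types x : Qp.

(* Z_p inside Q_p: |x|_p <= 1 (see padic_abs_le1). *)
Definition Zp_ball : set Qp := [set x | x = 0 \/ 0 <= padic_val x].

Definition pZp : set Qp := [set p%:R * z | z in Zp_ball].

(* p^(v_p(x)) / x *)
Definition unit_inv x : Qp := p%:R ^ padic_val x / x.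

(* b_1(x), for x nonzero; the default 0 is never reached, by schneider_digitP. *)
Definition schneider_digit x : nat :=
  xget 0%N [set b : nat | (0 < b < p)%N /\ pZp (unit_inv x - b%:R)].

Definition schneider_map x : Qp :=
  if x == 0 then 0 else unit_inv x - (schneider_digit x)%:R.

Lemma Zp_ballP (R : realType) x : Zp_ball x <-> padic_abs R x <= 1.
Proof.
rewrite /Zp_ball /=; have [->|x0] := eqVneq x 0.
  by rewrite /padic_abs eqxx ler01; split=> // _; left.
rewrite padic_abs_le1//; split=> [[/eqP|//]|]; last by right.
by rewrite (negbTE x0).
Qed.

Lemma pZpP x : pZp x <-> x = 0 \/ 0 < padic_val x.
Proof.
have p0 := padic_p_neq0 p_pr; split=> [[z /= z1 <-]|].
  have [->|z0] := eqVneq z 0; first by left; rewrite mulr0.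
  right; rewrite (padic_valM p0 z0) padic_val_p.
  case: z1 => [/eqP|]; first by rewrite (negbTE z0).
  by move: (padic_val z) => v; lia.
have [-> _|x0] := eqVneq x 0.
  by exists 0; rewrite ?mulr0//; left.
case=> [/eqP|xv]; first by rewrite (negbTE x0).
have V0 := invr_neq0 p0.
exists (p%:R^-1 * x); last exact: (mulVKf p0 x).
right; rewrite (padic_valM V0 x0) (padic_valV p0) padic_val_p.
by move: (padic_val x) xv => v; lia.
Qed.

Lemma unit_inv_val x : x != 0 -> unit_inv x != 0 /\ padic_val (unit_inv x) = 0.
Proof.
move=> x0; have V0 := invr_neq0 x0.
have pX0 : (p%:R : Qp) ^ padic_val x != 0 := expfz_neq0 _ (padic_p_neq0 p_pr).
rewrite /unit_inv; split; first exact: mulf_neq0 pX0 V0.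
by rewrite (padic_valM pX0 V0) padic_val_pX (padic_valV x0) subrr.
Qed.

Lemma schneider_digitP x : x != 0 ->
  (0 < schneider_digit x < p)%N /\
  pZp (unit_inv x - (schneider_digit x)%:R).
Proof.
move=> /unit_inv_val[y0 yv]; rewrite /schneider_digit.
set P := [set b : nat | _]; suff [c Pc] : exists c, P c.
  exact: (xgetPex 0%N (ex_intro _ c Pc)).
case: (padicP y0) yv => a b a0 b0 yE -> /eqP; rewrite subr_eq0 eqz_nat => /eqP ab.
have [c cp h] := zp_digit a0 b0 ab; exists c; split => //; apply/pZpP.
have bF : b%:F != 0 :> Qp by rewrite tofrac_eq0.
have -> : unit_inv x - c%:R = (a - c%:R * b)%:F / b%:F.
  by rewrite tofracB tofracM rmorph_nat mulrBl mulfK// -yE.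
have [->|n0] := eqVneq (a - c%:R * b) 0; first by left; rewrite tofrac0 mul0r.
by right; rewrite padic_val_frac// subr_gt0 ltz_nat zp_val_gt.
Qed.

Lemma schneider_map_pZp x : pZp (schneider_map x).
Proof.
rewrite /schneider_map; case: eqVneq => [_|/schneider_digitP[]//].
by apply/pZpP; left.
Qed.

Variable R : realType.

(* a_1(x) = v_p(x), with the convention v_p(0) = +oo: when the expansion of x
   terminates, a_n(x) = +oo from some rank on. *)
Definition schneider_a1 x : \bar R :=
  if x == 0 then +oo%E else ((padic_val x)%:~R)%:E.

(* a_n(x), for n >= 1 *)
Definition schneider_a (n : nat) x : \bar R :=
  schneider_a1 (iter n.-1 schneider_map x).

Definition E_inf (psi : nat -> R) : set (padic_metric R p_pr) :=
  [set x : Qp | pZp x /\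
    limn_einf (fun n => schneider_a n x * ((psi n)^-1)%:E)%E = 1%E].

Definition E_lim (psi : nat -> R) : set (padic_metric R p_pr) :=
  [set x : Qp | pZp x /\
    (schneider_a n x * ((psi n)^-1)%:E)%E @[n --> \oo] --> 1%E].

End Schneider.

Arguments E_inf {p} p_pr {R} psi _.
Arguments E_lim {p} p_pr {R} psi _.

(* Main.v *)
Require Import Defs.
From mathcomp Require Import all_boot all_order all_algebra.
From mathcomp Require Import all_classical all_reals all_analysis.
From HB Require Import structures.
From mathcomp Require Import ring lra zify.

(* If liminf a_n / psi(n) = 1 then a_n tends to infinity, so it is enough that
   the s-dimensional Hausdorff content C of the set A of all x whose digits
   a_n(x) are all at least M vanishes once M is large in terms of s > 0, and that
   preimages of C-null sets under T_p are C-null.  Put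
   B_M(A) = {x <> 0 | v_p(x) >= M and T_p(x) \in A}.  On the part of B_M(A) where
   v_p(x) = M and b_1(x) is fixed, T_p expands distances by p^M; the rest is
   B_(M+1)(A) = p B_M(A), because T_p(p x) = T_p(x).  Hence
     C(B_M(A)) <= p p^(-sM) C(A) + p^(-s) C(B_M(A)),
   with all the contents finite.  For M = 1 and C(A) = 0 this shows that the
   preimage of A is null; for A the set above, A is included in {0} U B_M(A), so
   C(A) <= C(B_M(A)) and C(A) = 0 as soon as p p^(-sM) < 1 - p^(-s). *)

Import Order.TTheory GRing.Theory Num.Theory.
Import numFieldNormedType.Exports.
Local Open Scope classical_set_scope.
Local Open Scope ring_scope.

Set Implicit Arguments.
Unset Strict Implicit.
Unset Printing Implicit Defensive.

(** * Hausdorff content: outer measure, behaviour under expanding maps, null sets *)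

Definition hausdorff_content (R : realType) (T : metricType R) (s : R)
    (A : set T) : \bar R :=
  ereal_inf [set (\sum_(0 <= k <oo) diam_pow s (U k))%E | U in
    [set U : (set T)^nat | A `<=` \bigcup_k U k]].

(* T with all sets measurable, so that mu_ext applies to every set function. *)
Definition discrete (R : realType) (T : metricType R) (x0 : T) : Type := T.
HB.instance Definition _ (R : realType) (T : metricType R) (x0 : T) :=
  Choice.copy (discrete x0) T.
HB.instance Definition _ (R : realType) (T : metricType R) (x0 : T) :=
  isPointed.Build (discrete x0) x0.
HB.instance Definition _ (R : realType) (T : metricType R) (x0 : T) :=
  @isMeasurable.Build default_measure_display (discrete x0)
    discrete_measurable discrete_measurable0
    discrete_measurableC discrete_measurableU.

Section HausdorffContent.
Context {R : realType} {T : metricType R}.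
Implicit Types (A B U : set T) (s : R).
Local Open Scope ereal_scope.

Lemma diam_ge0 U : U !=set0 -> 0 <= diam U.
Proof.
move=> [x Ux]; apply: ereal_sup_ubound; exists (x, x) => //.
by rewrite /= mdistxx.
Qed.

Lemma diam_le U (d : \bar R) :
  (forall x y, U x -> U y -> (mdist x y)%:E <= d) -> diam U <= d.
Proof. by move=> Ud; apply: ge_ereal_sup => _ [[x y] [/= Ux Uy] <-]; exact: Ud. Qed.

Lemma diam_pow0 s : diam_pow s (@set0 T) = 0.
Proof. by rewrite /diam_pow eqxx. Qed.

Lemma diam_pow_ge0 s U : 0 <= diam_pow s U.
Proof. by rewrite /diam_pow; case: ifP => // _; exact: poweR_ge0. Qed.

(** In [discrete x0] the measurability required of covers by [mu_ext] always holds. Countable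
    subadditivity is imported this way. *)
Lemma hausdorff_content_mu_ext s (x0 : T) :
  @hausdorff_content R T s =
  mu_ext (diam_pow s : set (discrete x0) -> \bar R).
Proof.
apply/funext => A; rewrite /hausdorff_content /mu_ext; congr ereal_inf.
apply/seteqP; split => _ [U AU <-]; exists U => //; by case: AU.
Qed.

Lemma le_hausdorff_content s A B : A `<=` B ->
  hausdorff_content s A <= hausdorff_content s B.
Proof.
move=> AB; apply/ereal_inf_le_tmp => _ [U BU <-]; exists U => //.
exact: subset_trans AB BU.
Qed.

Lemma hausdorff_content_ge0 s A : 0 <= hausdorff_content s A.
Proof.
apply: le_ereal_inf_tmp => _ [U _ <-]; apply: nneseries_ge0 => k _ _.
exact: diam_pow_ge0.
Qed.

Lemma hausdorff_content_le_diam_pow s A : hausdorff_content s A <= diam_pow s A.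
Proof.
apply: ereal_inf_lbound; exists (fun k => if k == 0%N then A else set0).
  by move=> x Ax; exists 0%N.
rewrite (@nneseries_recl R xpredT)//; last by move=> k _; exact: diam_pow_ge0.
by rewrite eseries0 ?adde0// => -[|k]// _ _; rewrite diam_pow0.
Qed.

Lemma hausdorff_content0 s : hausdorff_content s (@set0 T) = 0.
Proof.
apply/eqP; rewrite eq_le hausdorff_content_ge0 andbT -(diam_pow0 s).
exact: hausdorff_content_le_diam_pow.
Qed.

Lemma hausdorff_content_set1 s (x : T) : (0 < s)%R ->
  hausdorff_content s [set x] = 0.
Proof.
move=> s0; apply/eqP; rewrite eq_le hausdorff_content_ge0 andbT.
apply: le_trans (hausdorff_content_le_diam_pow _ _) _.
rewrite /diam_pow; case: eqVneq => // _.
suff -> : diam [set x] = 0 by rewrite poweR0r ?gt_eqF.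
apply/eqP; rewrite eq_le diam_ge0 ?andbT; last by exists x.
by apply: diam_le => _ _ -> ->; rewrite mdistxx.
Qed.

Lemma hausdorff_content_sigma_subadditive s :
  sigma_subadditive (@hausdorff_content R T s).
Proof.
(* [discrete] needs a base point, so an empty [T] is treated apart. *)
have [[x0 _]|T0] := pselect (exists x : T, True).
  rewrite (hausdorff_content_mu_ext s x0).
  exact: (@mu_ext_sigma_subadditive _ (discrete x0) _ _ (diam_pow_ge0 s)).
move=> F; have -> : \bigcup_n F n = set0.
  by apply/seteqP; split => // x _; apply: T0; exists x.
rewrite hausdorff_content0; apply: nneseries_ge0 => k _ _.
exact: hausdorff_content_ge0.
Qed.

HB.instance Definition _ s := isOuterMeasure.Build R T (@hausdorff_content R T s)
  (hausdorff_content0 s) (hausdorff_content_ge0 s)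
  (@le_hausdorff_content s) (@hausdorff_content_sigma_subadditive s).

(** A cover of [A], pulled back along [f] and cut down to [B], covers [B] with diameters multiplied
    by at most [c]. *)
Lemma hausdorff_content_expand (c s : R) A B (f : T -> T) : (0 <= s)%R -> (0 < c)%R ->
  B `<=` f @^-1` A ->
  (forall x y, B x -> B y -> (mdist x y <= c * mdist (f x) (f y))%R) ->
  hausdorff_content s B <= (c `^ s)%:E * hausdorff_content s A.
Proof.
move=> s0 c0 BA fc; have cs0 : (0 < c `^ s)%R by exact: powR_gt0.
rewrite -lee_pdivrMl//; apply: le_ereal_inf_tmp => _ [U AU <-].
rewrite lee_pdivrMl// -nneseriesZl//; last by move=> k _; exact: diam_pow_ge0.
apply: (@le_trans _ _ (\sum_(0 <= k <oo) diam_pow s (B `&` f @^-1` U k))).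
  apply: ereal_inf_lbound; exists (fun k => B `&` f @^-1` U k) => // x Bx.
  by have [k _ Uk] := AU _ (BA _ Bx); exists k.
apply: lee_nneseries => [k _ _|k _]; first exact: diam_pow_ge0.
have [V0|/set0P[x Vx]] := eqVneq (B `&` f @^-1` U k) set0.
  by rewrite V0 diam_pow0 mule_ge0 ?lee_fin ?powR_ge0 ?diam_pow_ge0.
have U0 : U k !=set0 by exists (f x); exact: Vx.2.
have V0 : B `&` f @^-1` U k !=set0 by exists x.
rewrite /diam_pow; move/set0P/negbTE: (U0) => ->; move/set0P/negbTE: (V0) => ->.
rewrite -poweR_EFin -poweRM ?lee_fin ?(ltW c0) ?diam_ge0//.
apply: gt0_ler_poweR => //.
- by rewrite in_itv /= leey diam_ge0.
- by rewrite in_itv /= leey mule_ge0 ?lee_fin ?(ltW c0) ?diam_ge0.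
apply: diam_le => y z [By Uy] [Bz Uz].
apply: (@le_trans _ _ (c * mdist (f y) (f z))%:E); first by rewrite lee_fin fc.
rewrite EFinM lee_pmul2l//; apply: ereal_sup_ubound.
by exists (f y, f z).
Qed.

Lemma hausdorff_measure_eq0 s A : (0 < s)%R ->
  hausdorff_content s A = 0 -> hausdorff_measure s A = 0.
Proof.
move=> s0 A0; have prem0 (d : R) : (0 < d)%R -> hausdorff_premeasure s d A = 0.
  move=> d0; apply/eqP; rewrite eq_le; apply/andP; split; last first.
    apply: le_ereal_inf_tmp => _ [U _ <-]; apply: nneseries_ge0 => k _ _.
    exact: diam_pow_ge0.
  apply/lee_addgt0Pr => e e0; rewrite add0e.
  (* The bound [e] makes the total weight small; the bound [d^s] applies to each single weight and
     so forces every diameter below [d]. *)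
  have : hausdorff_content s A < (Num.min e (d `^ s))%:E.
    by rewrite A0 lte_fin lt_min e0 powR_gt0.
  move=> /ereal_inf_lt[_ [U AU <-]]; rewrite EFin_min lt_min => /andP[Ue Ud].
  apply: le_trans (ltW Ue); apply: ereal_inf_lbound; exists U => //; split => // k.
  have : diam_pow s (U k) < d%:E `^ s.
    apply: le_lt_trans Ud; apply: le_trans (nneseries_lim_ge k.+1 _) => /=.
      by rewrite big_nat_recr//= leeDr// sume_ge0// => i _; exact: diam_pow_ge0.
    by move=> i _ _; exact: diam_pow_ge0.
  rewrite /diam_pow; case: eqVneq => [->|/set0P U0] h.
    by apply: diam_le.
  rewrite leNgt; apply/negP => dU; move: h; rewrite ltNge => /negP; apply.
  apply: gt0_ler_poweR; rewrite ?in_itv/= ?leey ?andbT ?lee_fin ?(ltW d0) ?(ltW s0)//.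
    exact: diam_ge0.
  exact: ltW.
apply/eqP; rewrite eq_le; apply/andP; split.
  by apply: ge_ereal_sup => _ [d d0 <-]; rewrite prem0.
by apply: ereal_sup_ubound; exists 1%R; [exact: ltr01|exact: prem0].
Qed.

Lemma hausdorff_dim_eq0 A :
  (forall s, (0 < s)%R -> hausdorff_content s A = 0) -> hausdorff_dim A = 0.
Proof.
move=> A0; apply/eqP; rewrite eq_le; apply/andP; split.
  apply/lee_addgt0Pr => e e0; rewrite add0e; apply: ereal_inf_lbound.
  by exists e => //; split; [exact: ltW|exact: hausdorff_measure_eq0 (A0 _ e0)].
by apply: le_ereal_inf_tmp => _ [s [s0 _] <-]; rewrite lee_fin.
Qed.

End HausdorffContent.

(** For [a = p^v] with [v] the common valuation of [x] and [y], and [d] their common digit, the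
    inner difference is [S y - S x] and [y / a] has absolute value 1. *)
Lemma sub_schneiderE (F : fieldType) (a x y d : F) : a != 0 -> x != 0 -> y != 0 ->
  x - y = x * ((a / y - d) - (a / x - d)) * (y / a).
Proof. by move=> a0 x0 y0; field; rewrite a0 x0 y0. Qed.

(** * Expansion by Schneider's map and the content of cylinders *)

Section Schneider.
Context {R : realType} {p : nat} {p_pr : prime p}.
Local Notation Qp := (padic p_pr).
Local Notation T := (padic_metric R p_pr).
Local Notation S := (@schneider_map p p_pr).
Local Notation content := (@hausdorff_content R T).
Local Notation q := (p%:R^-1 : R).
Implicit Types (x y : Qp) (A : set Qp) (s : R).

Lemma padic_mdistE x y : @mdist R T x y = padic_abs R (x - y).
Proof. by []. Qed.

Lemma padic_absE x : x != 0 -> padic_abs R x = (p%:R : R) ^ (- padic_val x).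
Proof. by rewrite /padic_abs => /negbTE ->. Qed.

Lemma schneider_map_expand x y : x != 0 -> y != 0 ->
  padic_val x = padic_val y -> schneider_digit x = schneider_digit y ->
  padic_abs R (x - y) =
  (p%:R : R) ^ (- padic_val x) * padic_abs R (S x - S y).
Proof.
move=> x0 y0 xyv xyd; have P0 : (p%:R : Qp) ^ padic_val x != 0 :=
  expfz_neq0 _ (padic_p_neq0 p_pr).
rewrite /schneider_map (negbTE x0) (negbTE y0) /unit_inv -xyv -xyd.
rewrite (sub_schneiderE (schneider_digit x)%:R P0 x0 y0) 2!padic_absM.
rewrite (padic_absE x0) (padic_absE (mulf_neq0 y0 (invr_neq0 P0))).
rewrite (padic_valM y0 (invr_neq0 P0)) (padic_valV P0) padic_val_pX -xyv subrr.
by rewrite oppr0 expr0z mulr1; congr (_ * _); exact: padic_distC.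
Qed.

(** This is B_M(A) of the opening comment. The point 0, which has no finite first digit, is treated
    separately as a null singleton. *)
Definition schneider_cylinder (M : nat) A : set Qp :=
  [set x : Qp | [/\ x != 0, M%:Z <= padic_val x & A (S x)]].

Lemma divp_neq0 x : x != 0 -> x / p%:R != 0.
Proof. by move=> x0; rewrite mulf_neq0// invr_neq0// padic_p_neq0. Qed.

Lemma padic_val_divp x : x != 0 -> padic_val (x / p%:R) = padic_val x - 1.
Proof.
move=> x0; have p0 := padic_p_neq0 p_pr.
by rewrite (padic_valM x0 (invr_neq0 p0)) (padic_valV p0) padic_val_p.
Qed.

(** The power of p cancels in [unit_inv], from which the digit and the image are both computed. *)
Lemma schneider_map_divp x : x != 0 -> S (x / p%:R) = S x.
Proof.
move=> x0; have p0 := padic_p_neq0 p_pr; have xp0 := divp_neq0 x0.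
have uE : unit_inv (x / p%:R) = unit_inv x.
  rewrite /unit_inv padic_val_divp// expfzDr// invfM invrK.
  by rewrite exprN1 mulrACA mulVf// mulr1.
by rewrite /schneider_map (negbTE x0) (negbTE xp0) /schneider_digit uE.
Qed.

Lemma hausdorff_content_pZp_le1 s : 0 <= s -> (content s (@pZp p p_pr) <= 1)%E.
Proof.
move=> s0; apply: le_trans (hausdorff_content_le_diam_pow _ _) _.
rewrite /diam_pow; case: eqVneq => [_|/set0P ne]; first by rewrite lee_fin ler01.
rewrite -(poweR1r s); apply: gt0_ler_poweR => //.
- by rewrite in_itv /= leey diam_ge0.
- by rewrite in_itv /= leey lee_fin ler01.
apply: diam_le => x y xp yp; rewrite lee_fin padic_mdistE.
apply: le_trans (padic_absD _ _ _) _; rewrite padic_absN ge_max.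
apply/andP; split; apply/Zp_ballP.
  by case/pZpP: xp => [|/ltW]; [left|right].
by case/pZpP: yp => [|/ltW]; [left|right].
Qed.

(** The piece [b = 0] is empty, digits being positive; keeping it gives the factor p instead of p -
    1 below. *)
Lemma sub_schneider_cylinder (M : nat) A :
  schneider_cylinder M A `<=`
    \big[setU/set0]_(b < p) (schneider_cylinder M A `&`
      [set x : Qp | padic_val x = M%:Z /\ schneider_digit x = b])
    `|` schneider_cylinder M.+1 A.
Proof.
move=> x Bx; have [x0 Mx Ax] := Bx.
have [xM|xM] := eqVneq (padic_val x) M%:Z; [left|right].
  have [/andP[_ bp] _] := schneider_digitP x0.
  by rewrite (bigD1 (Ordinal bp))//=; left.
by split => //; move: Mx xM; move: (padic_val x) => v; lia.
Qed.

Lemma hausdorff_content_schneider_cylinder (M : nat) A s : 0 < s ->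
  (content s (schneider_cylinder M A) <=
   (p%:R * (q ^+ M) `^ s)%:E * content s A +
   (q `^ s)%:E * content s (schneider_cylinder M A))%E.
Proof.
move=> s0; have p0 : (0 < p%:R :> R) by rewrite ltr0n prime_gt0.
apply: le_trans (@le_hausdorff_content R T s _ _ (@sub_schneider_cylinder M A)) _.
apply: le_trans (outer_measureU2 (content s) _ _) _; apply: leeD.
  apply: le_trans (outer_measure_subadditive (content s)
    (fun b => schneider_cylinder M A `&`
      [set x : Qp | padic_val x = M%:Z /\ schneider_digit x = b]) _) _ => /=.
  have le_b (b : 'I_p) : (content s (schneider_cylinder M A `&`
      [set x : Qp | padic_val x = M%:Z /\ schneider_digit x = b]) <=
      ((q ^+ M) `^ s)%:E * content s A)%E.
    apply: (@hausdorff_content_expand R T _ s A _ S).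
    - exact: ltW.
    - by rewrite exprn_gt0// invr_gt0.
    - by move=> x [[]].
    move=> x y [[x0 _ _] [xM xb]] [[y0 _ _] [yM yb]]; rewrite !padic_mdistE.
    rewrite (@schneider_map_expand x y)// ?xM ?yM ?xb ?yb//.
    by rewrite -exprnN exprVn.
  apply: le_trans (lee_sum _ (fun b _ => le_b b)) _.
  by rewrite sumr_const card_ord EFinM -muleA mule_natl.
(* Division by p sends B_(M+1)(A) into B_M(A) and multiplies distances by p, whence the factor
   [q^s]. *)
apply: (@hausdorff_content_expand R T _ s _ _ (fun x : Qp => x / p%:R)).
- exact: ltW.
- by rewrite invr_gt0.
- move=> x [x0 Mx Ax]; split; first exact: divp_neq0.
    rewrite padic_val_divp//.
    by move: Mx; move: (padic_val x) => v; lia.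
  by rewrite schneider_map_divp.
move=> x y _ _; rewrite !padic_mdistE.
have q0 : (p%:R : Qp)^-1 != 0 by rewrite invr_neq0// padic_p_neq0.
rewrite -mulrBl padic_absM mulrC (padic_absE q0) (padic_valV (padic_p_neq0 _)).
by rewrite padic_val_p opprK expr1z -mulrA mulfV ?mulr1// gt_eqF.
Qed.

Lemma schneider_cylinder_pZp (M : nat) A : (0 < M)%N ->
  schneider_cylinder M A `<=` @pZp p p_pr.
Proof.
move=> M0 x [_ Mx _]; apply/pZpP; right; apply: lt_le_trans Mx.
by rewrite ltz_nat.
Qed.

(** * Null sets from the cylinder inequality *)

Lemma powR_invp_lt1 s : 0 < s -> q `^ s < 1.
Proof.
move=> s0; have := @gt0_ltr_powR R s s0 q 1; rewrite powR1.
apply; rewrite ?nnegrE ?invr_ge0//.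
by rewrite invf_lt1 ?ltr1n ?ltr0n ?prime_gt1 ?prime_gt0.
Qed.

(** [(q^M)^s = (q^s)^M] tends to 0. The factor 1/2 leaves a strict gap: the two coefficients of the
    cylinder inequality add up to less than 1. *)
Lemma schneider_cylinder_ratio_small s : 0 < s ->
  exists2 M, (0 < M)%N & p%:R * (q ^+ M) `^ s <= (1 - q `^ s) / 2.
Proof.
move=> s0; have q1 := powR_invp_lt1 s0; have qs0 : 0 <= q `^ s by exact: powR_ge0.
have p0 : (0 < p%:R :> R) by rewrite ltr0n prime_gt0.
have e0 : 0 < (1 - q `^ s) / 2 / p%:R by rewrite !divr_gt0// subr_gt0.
have : (q `^ s) ^+ n @[n --> \oo] --> 0 by apply: cvg_expr; rewrite ger0_norm.
move=> /cvgr_lt /(_ _ e0)[M _ Mn]; exists M.+1 => //.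
have := Mn M.+1 (leqnSn M); rewrite /= ltr_pdivlMr// mulrC => /ltW.
suff -> : (q ^+ M.+1) `^ s = (q `^ s) ^+ M.+1 by [].
by rewrite -!powR_mulrn ?powR_ge0 ?invr_ge0// -!powRrM mulrC.
Qed.

(** Finiteness turns the cylinder inequality into one between real numbers, where a term can be
    moved across. *)
Lemma hausdorff_content_pZp_fin_num s A : 0 <= s -> A `<=` @pZp p p_pr ->
  content s A \is a fin_num.
Proof.
move=> s0 AZ; rewrite ge0_fin_numE ?hausdorff_content_ge0//.
apply: le_lt_trans (@le_hausdorff_content R T s _ _ AZ) _.
exact: le_lt_trans (hausdorff_content_pZp_le1 s0) (ltry 1).
Qed.

Lemma schneider_cylinder_null A s : 0 < s ->
  content s A = 0%E -> content s (schneider_cylinder 1 A) = 0%E.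
Proof.
move=> s0 A0; have := @hausdorff_content_schneider_cylinder 1 A s s0.
have := hausdorff_content_pZp_fin_num (ltW s0) (@schneider_cylinder_pZp 1 A isT).
have := @hausdorff_content_ge0 R T s (schneider_cylinder 1 A).
rewrite A0 mule0 add0e; case: (content s _) => // c.
rewrite -EFinM !lee_fin => c0 _ cq; have q1 := powR_invp_lt1 s0.
(* Here [0 <= c <= q^s c] with [q^s < 1]. *)
by congr EFin; nra.
Qed.

(** The case 0 admits terminating expansions, whose later a_n are +oo by convention. *)
Definition large_digits (M : nat) : set Qp :=
  [set x : Qp | forall n, iter n S x = 0 \/ M%:Z <= padic_val (iter n S x)].

Lemma hausdorff_content_large_digits s : 0 < s ->
  exists2 M, (0 < M)%N & content s (large_digits M) = 0%E.
Proof.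
move=> s0; have [M M0 Mq] := schneider_cylinder_ratio_small s0; exists M => //.
have AB : large_digits M `<=` [set (0 : Qp)] `|` schneider_cylinder M (large_digits M).
  move=> x Ax; have [x0|x0] := eqVneq x 0; [by left|right]; split => //.
    by case: (Ax 0%N) => //= x0'; case/eqP: x0.
  by move=> n; have := Ax n.+1; rewrite iterSr.
have AB' := le_trans (@le_hausdorff_content R T s _ _ AB)
  (outer_measureU2 (content s) _ _).
have := @hausdorff_content_schneider_cylinder M (large_digits M) s s0.
have := hausdorff_content_pZp_fin_num (ltW s0)
  (@schneider_cylinder_pZp M (large_digits M) M0).
have := @hausdorff_content_ge0 R T s (large_digits M).
move: AB'; rewrite /= (@hausdorff_content_set1 R T)// add0e.
case: (content s (schneider_cylinder _ _)) => // b.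
case: (content s _) => // a.
rewrite -!EFinM -EFinD !lee_fin => ab a0 _ bq; have q1 := powR_invp_lt1 s0.
congr EFin; move: Mq bq q1; move: (p%:R * _) (q `^ s) => t r Mq bq q1.
(* From [b <= t a + r b], [t <= (1 - r) / 2] and [0 <= a <= b] follows [(1 - r) b <= (1 - r) b / 2],
   so [b <= 0] and [a = 0]. *)
by nra.
Qed.

(** Induction peels off the first application of [S]: a nonzero point of pZ_p has valuation at least
    1, so it lies in B_1 of the previous preimage. *)
Lemma schneider_iter_preimage_null A s (N : nat) : 0 < s -> content s A = 0%E ->
  content s [set x : Qp | pZp x /\ A (iter N S x)] = 0%E.
Proof.
move=> s0 A0; elim: N => [|N IH]; apply/eqP; rewrite eq_le hausdorff_content_ge0 andbT.
  by rewrite -A0; apply: (@le_hausdorff_content R T) => x [].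
set D : set Qp := (X in content s X = _) in IH.
have DB : [set x : Qp | pZp x /\ A (iter N.+1 S x)] `<=`
    [set (0 : Qp)] `|` schneider_cylinder 1 D.
  move=> x [xp Ax]; have [x0|x0] := eqVneq x 0; [by left|right]; split => //.
    by case/pZpP: xp => // /eqP; rewrite (negbTE x0).
  by split; [exact: schneider_map_pZp|rewrite -iterSr].
apply: le_trans (@le_hausdorff_content R T s _ _ DB) _.
apply: le_trans (outer_measureU2 (content s) _ _) _ => /=.
by rewrite (@hausdorff_content_set1 R T)// schneider_cylinder_null// adde0.
Qed.

(** Eventually a_n / psi(n) > 1/2, as the liminf is 1, and psi(n) >= 2M; hence a_n >= M. *)
Lemma eventually_large_digits (psi : nat -> R) (M : nat) x :
  (forall n, (0 < n)%N -> 0 < psi n) -> psi n @[n --> \oo] --> +oo ->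
  limn_einf (fun n => schneider_a R n x * ((psi n)^-1)%:E)%E = 1%E ->
  exists N, large_digits M (iter N S x).
Proof.
move=> psi0 psioo; rewrite limn_einf_lim => u1.
set u := (fun n => _) in u1.
have [N1 HN1] : exists N, ((1 / 2)%:E < einfs u N)%E.
  apply: contrapT => /forallNP uN.
  have : (limn (einfs u) <= (1 / 2)%:E)%E.
    apply: lime_le; first exact: is_cvg_einfs.
    by apply: nearW => n; rewrite leNgt; exact/negP.
  by rewrite u1 lee_fin; lra.
have [N2 _ HN2] : \forall n \near \oo, M%:R * 2 <= psi n.
  by move/cvgryPge: psioo; exact.
exists (maxn N1 N2) => k; rewrite -iterD.
set n := (k + maxn N1 N2)%N.
have [xn0|xn0] := eqVneq (iter n S x) 0; [by left|right].
(* The valuation of the [n]-th iterate is the digit of index [n.+1]. *)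
have psin : M%:R * 2 <= psi n.+1.
  by apply: HN2 => /=; rewrite leqW// /n (leq_trans (leq_maxr N1 _))// leq_addl.
have un : ((1/2)%:E < u n.+1)%E.
  apply: lt_le_trans HN1 _; apply: ereal_inf_lbound.
  by exists n.+1 => //=; rewrite leqW// /n (leq_trans (leq_maxl _ N2))// leq_addl.
have pn0 := psi0 n.+1 isT.
move: un; rewrite /u /schneider_a /= /schneider_a1 (negbTE xn0) -EFinM lte_fin.
rewrite ltr_pdivlMr// => un.
have : (M%:R : R) <= (padic_val (iter n S x))%:~R by lra.
by rewrite pmulrn ler_int.
Qed.

End Schneider.

Theorem theorem2 (R : realType) (p : nat) (p_pr : prime p) (psi : nat -> R)
    (psi_gt0 : forall n, (0 < n)%N -> 0 < psi n)
    (psi_oo : psi n @[n --> \oo] --> +oo) :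
  hausdorff_dim (E_inf p_pr psi) = 0%E /\ hausdorff_dim (E_lim p_pr psi) = 0%E.
Proof.
have Einf0 s : 0 < s -> hausdorff_content s (E_inf p_pr psi) = 0%E.
  move=> s0; have [M M0 AM] := @hausdorff_content_large_digits R p p_pr s s0.
  pose D N : set (padic p_pr) :=
    [set x : padic p_pr | pZp x /\ large_digits M (iter N (@schneider_map p p_pr) x)].
  (* The rank from which the digits are large depends on [x], hence a countable union. *)
  have ED : E_inf p_pr psi `<=` \bigcup_N D N.
    move=> x [xp /(eventually_large_digits M psi_gt0 psi_oo)[N xN]].
    by exists N.
  apply/eqP; rewrite eq_le hausdorff_content_ge0 andbT.
  apply: le_trans (@le_hausdorff_content R (padic_metric R p_pr) s _ _ ED) _.
  apply: le_trans (hausdorff_content_sigma_subadditive s _) _.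
  by rewrite eseries0// => N _ _; exact: schneider_iter_preimage_null.
split; apply: hausdorff_dim_eq0 => s s0; first exact: Einf0.
apply/eqP; rewrite eq_le hausdorff_content_ge0 andbT -(Einf0 s s0).
(* A limit equal to 1 is also the liminf, so [E_lim] is included in [E_inf]. *)
apply: le_hausdorff_content => x [xp xlim]; split => //.
by have [-> _] := cvg_limn_einf_sup xlim.
Qed.
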